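(* Let $k$ be an algebraically closed field. If $A$ and $B$ are two standard graded $k$-algebras such that $A\otimes_k B\cong k[P]$ as graded $k$-algebras for some normal lattice polytope $P$, then both $A$ and $B$ are polytopal.
   Context: A standard graded $k$-algebra is a (commutative) graded $k$-algebra $A=k\oplus A_1\oplus A_2\oplus\cdots$ which is finitely generated and generated by $A_1$. For standard graded $A=k\oplus A_1\oplus\cdots$ and $B=k\oplus B_1\oplus\cdots$ the tensor product is graded by $A\otimes_k B=k\oplus C_1\oplus C_2\oplus\cdots$, $C_h=\bigoplus_{i+j=h}A_i\otimes_k B_j$. A lattice polytope $P\subset\mathbb{R}^n$ is the convex hull of a finite set of points of $\mathbb{Z}^n$ (the empty polytope is allowed, with $k[\emptyset]=k$). Put $L_P=P\cap\mathbb{Z}^n$, and let $S_P\subset\mathbb{Z}^{n+1}$ be the sub-semigroup (with $0$) generated by $\{(x,1)\mid x\in L_P\}$. The algebra $k[P]:=k[S_P]$ is the semigroup algebra of $S_P$, graded by the last coordinate. $P$ is called normal if $k[P]$ is a normal domain (equivalently, $S_P$ is a normal semigroup). A graded $k$-algebra is called polytopal if it is isomorphic, as a graded $k$-algebra, to $k[Q]$ for some lattice polytope $Q$. *)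

(* Defs.v *)
From HB Require Import structures.
From mathcomp Require Import all_boot all_order all_algebra.
From mathcomp Require Import monalg.
From mathcomp Require Import boolp classical_sets reals.

Set Implicit Arguments.
Unset Strict Implicit.
Unset Printing Implicit Defensive.

Import Order.TTheory GRing.Theory Num.Theory.

Local Open Scope classical_set_scope.
Local Open Scope ring_scope.

Section GradedAlgebras.
Variable k : fieldType.
Implicit Types A B T : comAlgType k.

Definition subalg_generated A (X : set A) : set A :=
  [set x | forall S : {pred A},
     GRing.subalg_closed S -> (forall y, X y -> y \in S) -> x \in S].

(* A grading A = \bigoplus_i gA i, with homogeneous components gA i. *)
Record graded_algebra A (gA : nat -> set A) : Prop := GradedAlgebra {
  graded_submod : forall i, GRing.submod_closed [in gA i];
  graded_mul : forall i j x y, gA i x -> gA j y -> gA (i + j)%N (x * y);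
  graded_span : forall x, exists n (c : nat -> A),
    (forall i, gA i (c i)) /\ x = \sum_(i < n) c i;
  graded_direct : forall n (c : nat -> A), (forall i, gA i (c i)) ->
    \sum_(i < n) c i = 0 -> forall i, (i < n)%N -> c i = 0
}.

Record standard_graded A (gA : nat -> set A) : Prop := StandardGraded {
  standard_is_graded :> graded_algebra gA;
  standard_degree0 : gA 0%N = range (fun a : k => a%:A);
  standard_finite : exists s : seq A, subalg_generated [set` s] = setT;
  standard_degree1 : subalg_generated (gA 1%N) = setT
}.

Definition graded_iso A B (gA : nat -> set A) (gB : nat -> set B) : Prop :=
  exists f : {lrmorphism A -> B},
    bijective f /\ forall i x, gA i x <-> gB i (f x).

(* The algebra T, with a (x) b := t a b, is the tensor product of A and B over
   k: t is the universal k-bilinear map on A x B, and the multiplication of T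
   is the one determined by (a (x) b) (a' (x) b') = a a' (x) b b'. *)
Record is_tensor_product A B T (t : {bilinear A -> B -> T}) : Prop :=
  IsTensorProduct {
    tensor_universal : forall (V : lmodType k) (b : {bilinear A -> B -> V}),
      exists2 g : {linear T -> V}, (forall x y, g (t x y) = b x y) &
        forall g' : {linear T -> V}, (forall x y, g' (t x y) = b x y) ->
          g' =1 g;
    tensor_mul : forall x x' y y', t x y * t x' y' = t (x * x') (y * y');
    tensor_one : t 1 1 = 1
  }.

(* U (x) V inside T, for subspaces U of A and V of B. *)
Definition tensor_subspace A B T (t : {bilinear A -> B -> T})
    (U : set A) (V : set B) : set T :=
  [set z | exists m (u : 'I_m -> A) (v : 'I_m -> B),
     [/\ forall l, U (u l), forall l, V (v l) & z = \sum_l t (u l) (v l)]].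

(* C_h = \bigoplus_(i + j = h) A_i (x) B_j *)
Definition tensor_grading A B T (t : {bilinear A -> B -> T})
    (gA : nat -> set A) (gB : nat -> set B) (h : nat) : set T :=
  [set z | exists2 c : 'I_h.+1 -> T,
     forall i : 'I_h.+1, tensor_subspace t (gA i) (gB (h - i)%N) (c i) &
     z = \sum_i c i].

End GradedAlgebras.

(* D is a domain integrally closed in its field of fractions (F, via f). *)
Definition normal_domain (D : comNzRingType) : Prop :=
  exists (F : fieldType) (f : {rmorphism D -> F}),
    [/\ injective f,
        forall z, exists a b, b != 0 /\ z = f a / f b &
        forall z, integralOver f z -> exists d, z = f d].

Section LatticePolytopes.
Variables (R : realType) (n : nat).
Implicit Type P : set 'rV[R]_n.

Definition lattice_vec (x : 'rV[int]_n) : 'rV[R]_n := map_mx intr x.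

Definition lattice_polytope P : Prop :=
  exists m (v : 'I_m -> 'rV[int]_n),
    P = [set x | exists w : 'I_m -> R,
          [/\ forall i, 0 <= w i, \sum_i w i = 1 &
              x = \sum_i w i *: lattice_vec (v i)]].

Definition lattice_points P : set 'rV[int]_n := [set x | P (lattice_vec x)].

(* S_P, the submonoid of Z^(n+1) generated by the (x, 1) with x in L_P. *)
Definition in_semigroup P : {pred 'rV[int]_(n + 1)} :=
  [pred s | `[< forall S : {pred 'rV[int]_(n + 1)},
     GRing.addr_closed S ->
     (forall x, lattice_points P x -> row_mx x (const_mx 1) \in S) ->
     s \in S >]].

Record semigroup P :=
  Semigroup { semigroup_val :> 'rV[int]_(n + 1);
              semigroup_valP : semigroup_val \in in_semigroup P }.

HB.instance Definition _ P := [isSub for @semigroup_val P].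
HB.instance Definition _ P := [Choice of semigroup P by <:].

Definition last_coord (s : 'rV[int]_(n + 1)) : int := s 0 (rshift n ord0).

Section Monoid.
Variable P : set 'rV[R]_n.
Implicit Types s t : semigroup P.

Fact sg_zero_subproof : 0 \in in_semigroup P.
Proof. by apply/asboolP => S [S0 _] _. Qed.

Fact sg_add_subproof s t : semigroup_val s + semigroup_val t \in in_semigroup P.
Proof.
apply/asboolP => S clS genS; case: (clS) => _; apply.
- by move/asboolP: (semigroup_valP s); apply.
- by move/asboolP: (semigroup_valP t); apply.
Qed.

Definition sg_zero : semigroup P := Semigroup sg_zero_subproof.
Definition sg_add s t : semigroup P := Semigroup (sg_add_subproof s t).

Lemma sg_last_coord s : (0 < last_coord s) || (semigroup_val s == 0).
Proof.
pose S : {pred 'rV[int]_(n + 1)} := [pred u | (0 < last_coord u) || (u == 0)].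
have/asboolP/(_ S) := semigroup_valP s; apply.
- split=> [|x y]; rewrite !inE ?eqxx ?orbT //.
  have lcD : last_coord (x + y) = last_coord x + last_coord y.
    by rewrite /last_coord mxE.
  case/orP=> [x_gt0 /orP[y_gt0|/eqP->]|/eqP-> /orP[y_gt0|/eqP->]].
  + by rewrite lcD addr_gt0.
  + by rewrite addr0 x_gt0.
  + by rewrite add0r y_gt0.
  + by rewrite addr0 eqxx orbT.
- by move=> x _; rewrite inE /last_coord row_mxEr mxE ltr01.
Qed.

Fact sg_addA : associative sg_add.
Proof. by move=> x y z; apply: val_inj; apply: addrA. Qed.

Fact sg_add0 : left_id sg_zero sg_add.
Proof. by move=> x; apply: val_inj; apply: add0r. Qed.

Fact sg_addr0 : right_id sg_zero sg_add.
Proof. by move=> x; apply: val_inj; apply: addr0. Qed.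

Fact sg_addC : commutative sg_add.
Proof. by move=> x y; apply: val_inj; apply: addrC. Qed.

Fact sg_add_eq0 s t : sg_add s t = sg_zero -> s = sg_zero /\ t = sg_zero.
Proof.
move=> /(congr1 (@semigroup_val P)) /= st0.
have lc0 : last_coord s + last_coord t = 0.
  by have /matrixP/(_ 0 (rshift n ord0)) := st0; rewrite !mxE.
have [/orP[s_gt0|/eqP s0]] := sg_last_coord s; last first.
  by split; apply: val_inj => //=; rewrite -st0 s0 add0r.
have [/orP[t_gt0|/eqP t0]] := sg_last_coord t; last first.
  by split; apply: val_inj => //=; rewrite -st0 t0 addr0.
by have := addr_gt0 s_gt0 t_gt0; rewrite lc0 ltxx.
Qed.

(* Written multiplicatively, as required by monalg. *)
HB.instance Definition _ := Choice_isMonomialDef.Build (semigroup P)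
  sg_addA sg_add0 sg_addr0 sg_add_eq0.
HB.instance Definition _ :=
  MonomialDef_isConomialDef.Build (semigroup P) sg_addC.

End Monoid.

(* k[P] = k[S_P] *)
Definition polytope_algebra (k : fieldType) P : comAlgType k :=
  {malg k[semigroup P]}.

Definition polytope_grading (k : fieldType) P (h : nat) :
    set (polytope_algebra k P) :=
  [set f | forall s : semigroup P, mcoeff s f != 0 -> last_coord s = h%:Z].

Definition normal_polytope (k : fieldType) P : Prop :=
  normal_domain (polytope_algebra k P).

End LatticePolytopes.

Arguments polytope_algebra {R n} k P.
Arguments polytope_grading {R n} k P h.
Arguments normal_polytope {R n} k P.

Definition polytopal (R : realType) (k : fieldType) (A : comAlgType k)
    (gA : nat -> set A) : Prop :=
  exists n (Q : set 'rV[R]_n),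
    lattice_polytope Q /\ graded_iso gA (polytope_grading k Q).

Arguments polytopal R {k A} gA.

(* Main.v *)
From HB Require Import structures.
Require Import Defs.
From mathcomp Require Import all_boot all_order all_algebra.
From mathcomp Require Import finmap.
From mathcomp Require Import monalg.
From mathcomp Require Import boolp classical_sets reals.

Set Implicit Arguments.
Unset Strict Implicit.
Unset Printing Implicit Defensive.

Import Order.TTheory GRing.Theory Num.Theory.

Local Open Scope classical_set_scope.
Local Open Scope ring_scope.

(** Let [x_1, ..., x_N] be the monomials of degree 1 of [k[P]], one for each
    lattice point of [P].  The isomorphism identifies the degree 1 part of [k[P]]
    with the direct sum of [A_1] and [B_1], so that [x_i = v_i + w_i] with [v_i]
    in [A_1] and [w_i] in [B_1].  If every [x_i] were in [A_1] or in [B_1], then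
    [A] and [B] would visibly be the algebras of two faces of [P].  In general
    this holds only up to an automorphism, as one sees from the conjugacy of
    maximal tori in the group of graded automorphisms of [k[P]]; the proof below
    is elementary and finds the faces directly.

    The determinant is multilinear, so the [x_i] can be replaced one by one by
    [v_i] or [w_i] in such a way that they remain a basis ([mixed_rows_unit]).
    This gives a set [I] of lattice points such that the [v_i] with [i] in [I] are
    a basis of [A_1] and the [w_i] with [i] outside [I] are a basis of [B_1]
    ([split_basis]).

    The set [I] consists of the lattice points of a face ([splitting_face]).  Given
    [y] and [z] in [k[P]] there is an endomorphism of [k[P]] that multiplies [A_i]
    by [y ^+ i] and [B_j] by [z ^+ j].  Since [k[P]] is a domain, the monomials
    not killed by a given endomorphism form a face of the semigroup.  For
    [y = 1] and [z = 0] this excludes the [x_i] in [B_1].  For [y = w_j] and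
    [z = - v_j], both nonzero, the image of [x_i] is [v_i w_j - w_i v_j], a
    difference of two pure tensors that vanishes only if [x_i] is proportional
    to [x_j]; so this endomorphism excludes just [x_j].  Intersecting the faces
    obtained in this way for [j] outside [I] leaves [I].

    Let [Q] be the convex hull of [I]; its lattice points are those of [I]
    ([face_lattice_pointsP]).  Setting the monomials outside the face to 0 is a
    retraction of [k[P]] onto [k[Q]] ([face_retraction]), which maps [A] onto
    [k[Q]].  On the other hand [k[Q]] is contained in [k[P]], and the projection of
    [k[P]] onto [A] maps it onto [A].  As the homogeneous components are finite
    dimensional, the composite endomorphism of [k[Q]] is bijective
    ([graded_surj_inj]), hence [A] is isomorphic to [k[Q]]
    ([splitting_polytopal]).  The situation is symmetric in [A] and [B]. *)

(** * Morphisms *)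

Lemma lrmorphism_exists (k : fieldType) (A B : comAlgType k) (f : A -> B) :
  linear f -> monoid_morphism f -> exists g : {lrmorphism A -> B}, g =1 f.
Proof.
move=> f_lin f_mul.
pose fL := GRing.isLinear.Build k A B *:%R f f_lin.
pose fM := GRing.isMonoidMorphism.Build A B f f_mul.
pose g : {lrmorphism A -> B} := HB.pack f fL fM.
by exists g.
Qed.

Lemma bilinear_exists (k : fieldType) (U U' V : lmodType k) (f : U -> U' -> V) :
  (forall y, linear (f^~ y)) -> (forall x, linear (f x)) ->
  exists g : {bilinear U -> U' -> V}, forall x y, g x y = f x y.
Proof.
move=> fl fr.
have fB : bilinear_for *:%R *:%R f by split.
pose fm := bilinear_isBilinear.Build k U U' V *:%R *:%R f fB.
pose g : {bilinear U -> U' -> V} := HB.pack f fm.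
by exists g.
Qed.

Lemma inverse_lrmorphism (k : fieldType) (A B : comAlgType k)
    (f : {lrmorphism A -> B}) :
  bijective f -> exists2 g : {lrmorphism B -> A}, cancel f g & cancel g f.
Proof.
case=> g fK gK.
have [h hE] := lrmorphism_exists (can2_linear fK gK) (can2_monoid_morphism fK gK).
by exists h => x; rewrite hE.
Qed.

(** * Choosing rows of two matrices *)

(** If one row of an invertible matrix is a sum of two rows, then substituting
    one of the two summands keeps the matrix invertible, because the determinant
    is additive in that row.  Apply this to the rows one after the other. *)
Lemma mixed_rows_unit (F : fieldType) N (V W : 'M[F]_N) :
  V + W \in unitmx ->
  exists I : {set 'I_N},
    \matrix_i (if i \in I then row i V else row i W) \in unitmx.
Proof.
move=> VWu.
(* The choice is already made for the rows before [m]. *)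
pose mix m (I : {set 'I_N}) : 'M_N := \matrix_i
  (if (i < m)%N then if i \in I then row i V else row i W else row i (V + W)).
suff /(_ N (leqnn N)) [I Iu] : forall m, (m <= N)%N ->
    exists I, mix m I \in unitmx.
  exists I; congr (_ \in unitmx): Iu.
  by apply/row_matrixP => i; rewrite !rowK ltn_ord.
elim=> [_|m IHm lt_mN].
  exists finset.set0; congr (_ \in unitmx): VWu.
  by apply/row_matrixP => i; rewrite rowK.
have [I Iu] := IHm (ltnW lt_mN).
pose i0 := Ordinal lt_mN.
have other_rows (J : {set 'I_N}) : (forall i, i != i0 -> (i \in J) = (i \in I)) ->
    row' i0 (mix m.+1 J) = row' i0 (mix m I).
  move=> JI; apply/row_matrixP => i; rewrite !row'Esub !row_rowsub !rowK.
  have i_i0 : lift i0 i != i0 by rewrite eq_sym neq_lift.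
  by rewrite JI // ltnS leq_eqVlt -[_ == m]/(lift i0 i == i0) (negPf i_i0).
have detE : \det (mix m I) = 1 * \det (mix m.+1 (i0 |: I)) +
                             1 * \det (mix m.+1 (I :\ i0)%SET).
  apply: (@determinant_multilinear _ _ _ _ _ i0).
  - by rewrite !rowK ltnn ltnSn !inE eqxx /= !scale1r linearD.
  - by apply: other_rows => i /negPf i_i0; rewrite !inE i_i0.
  - by apply: other_rows => i /negPf i_i0; rewrite !inE i_i0.
move: Iu; rewrite unitmxE unitfE detE !mul1r => Iu.
have [D0|D1] := eqVneq (\det (mix m.+1 (i0 |: I))) 0; last first.
  by exists (i0 |: I); rewrite unitmxE unitfE.
by exists (I :\ i0)%SET; rewrite unitmxE unitfE; rewrite D0 add0r in Iu.
Qed.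

(** * Semigroup algebras of polytopes *)

Section PolytopeAlgebra.
Variables (R : realType) (n : nat) (k : fieldType) (P : set 'rV[R]_n).
Implicit Types (x : 'rV[int]_n) (s t : semigroup P).

Local Notation one_lift x := (row_mx x (const_mx 1) : 'rV[int]_(n + 1)).

Lemma lift_in_semigroup x :
  lattice_points P x -> one_lift x \in in_semigroup P.
Proof. by move=> Px; apply/asboolP => S _; apply. Qed.

(** The semigroup element [(x, 1)]; points outside the polytope are sent to the
    junk value 0, so that [pt] is total. *)
Definition pt x : semigroup P := insubd (sg_zero P) (one_lift x).

Lemma val_pt x : lattice_points P x -> semigroup_val (pt x) = one_lift x.
Proof. by move=> Px; apply: (insubdK _ (lift_in_semigroup Px)). Qed.

Lemma semigroup_ind (C : semigroup P -> Prop) :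
  C (sg_zero P) -> (forall s t, C s -> C t -> C (sg_add s t)) ->
  (forall x, lattice_points P x -> C (pt x)) -> forall t, C t.
Proof.
move=> C0 CD Cpt t.
pose S : {pred 'rV[int]_(n + 1)} := [pred u |
  `[< exists2 s, semigroup_val s = u & C s >]].
suff /asboolP[s /val_inj <-] : semigroup_val t \in S by [].
move/asboolP: (semigroup_valP t); apply.
- split=> [|u v]; first by apply/asboolP; exists (sg_zero P).
  move=> /asboolP[s <- Cs] /asboolP[s' <- Cs']; apply/asboolP.
  by exists (sg_add s s') => //; apply: CD.
- by move=> x Px; apply/asboolP; exists (pt x); [apply: val_pt|apply: Cpt].
Qed.

Lemma last_coordD s t :
  last_coord (sg_add s t) = last_coord s + last_coord t.
Proof. by rewrite /last_coord mxE. Qed.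

Lemma last_coord_pt x : lattice_points P x -> last_coord (pt x) = 1.
Proof. by move=> Px; rewrite /last_coord val_pt // row_mxEr mxE. Qed.

Local Notation kP := (polytope_algebra k P).
Definition mono t : kP := << t >>.

Definition coefm t (f : kP) : k := mcoeff t f.

Lemma mono0 : mono (sg_zero P) = 1. Proof. by []. Qed.

Lemma monoD s t : mono (sg_add s t) = mono s * mono t.
Proof. by rewrite /mono malgM_def fgmulUU mulr1. Qed.

Lemma coefm_mono s t : coefm t (mono s) = (s == t)%:R.
Proof. exact: mcoeffU1. Qed.

Lemma coefm_linear t : linear_for *%R (coefm t).
Proof. by move=> a f g; rewrite /coefm mcoeffD mcoeffZ. Qed.

Lemma coefm_0 t : coefm t 0 = 0.
Proof. exact: mcoeff0. Qed.

Lemma coefm_sum (I : Type) (r : seq I) (c : I -> k) (F : I -> kP) t :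
  coefm t (\sum_(i <- r) c i *: F i) = \sum_(i <- r) c i * coefm t (F i).
Proof.
elim/big_rec2: _ => [|i a f _ <-]; first exact: coefm_0.
exact: coefm_linear.
Qed.

Lemma coefm_1 : coefm (sg_zero P) 1 = 1.
Proof. by rewrite /coefm mcoeff1 eqxx. Qed.

Lemma coefm_inj f g : (forall t, coefm t f = coefm t g) -> f = g.
Proof. by move/malgP. Qed.

Lemma mono_expansion (f : kP) :
  exists s : seq (semigroup P), f = \sum_(t <- s) coefm t f *: mono t.
Proof.
exists (msupp f); rewrite {1}[f]monalgE; apply: eq_bigr => t _.
by apply/malgP => s; rewrite mcoeffU mcoeffZ [(mono t)@_s]coefm_mono mulr_natr.
Qed.

Lemma polytope_algebra_ind (C : kP -> Prop) : C 0 ->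
  (forall a t f, C f -> C (a *: mono t + f)) -> forall f, C f.
Proof.
move=> C0 CX f; have [s ->] := mono_expansion f.
by elim/big_rec: _ => // t g _; apply: CX.
Qed.

Lemma subalg_closed_full (S : {pred kP}) :
  GRing.subalg_closed S -> (forall x, lattice_points P x -> mono (pt x) \in S) ->
  forall f, f \in S.
Proof.
move=> clS SX f; have [S1 _ SM] := clS.
have [S0 Slin] := GRing.subalg_closedZ clS.
elim/polytope_algebra_ind: f => // a t g Sg.
have St : mono t \in S.
  elim/semigroup_ind: t => [|s t Ss St|//].
    by rewrite mono0.
  rewrite monoD.
  exact: (SM _ _ Ss St).
exact: (Slin a _ _ St Sg).
Qed.

Lemma lrmorphism_of_monoid (C : comAlgType k) (h : semigroup P -> C) :
  h (sg_zero P) = 1 -> (forall s t, h (sg_add s t) = h s * h t) ->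
  exists g : {lrmorphism kP -> C}, forall t, g (mono t) = h t.
Proof.
move=> h0 hD.
have hM : mmorphism h by split.
pose hm := isMultiplicative.Build (semigroup P) C h hM.
pose hh : {mmorphism semigroup P -> C} := HB.pack h hm.
have gM : monoid_morphism (mmap (in_alg C) hh).
  by have [gM g1] := mmap_is_multiplicative (f := in_alg C) (h := hh); split.
have gL : linear (mmap (in_alg C) hh).
  by move=> a f g; rewrite mmapD mmapZ /= mulr_algl.
have [g gE] := lrmorphism_exists gL gM.
by exists g => t; rewrite gE /mono mmapU /= scale1r mul1r.
Qed.

Lemma normal_polytope_mulf_eq0 : normal_polytope k P ->
  forall f g : kP, f * g = 0 -> f = 0 \/ g = 0.
Proof.
case=> F [j [j_inj _ _]] f g /(congr1 j).
rewrite rmorphM rmorph0 => /eqP; rewrite mulf_eq0.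
by case/orP=> /eqP e; [left|right]; apply: j_inj; rewrite rmorph0.
Qed.

Lemma polytope_gradingP h (f : kP) :
  polytope_grading k P h f <-> forall t, last_coord t != h%:Z -> coefm t f = 0.
Proof.
split=> [fh t|fh t ft]; first by apply: contraNeq => /fh ->.
by apply/eqP; apply: contraNT ft => /fh; rewrite /coefm => ->.
Qed.

Lemma polytope_grading_submod h : GRing.submod_closed [in polytope_grading k P h].
Proof.
split; first by rewrite inE; apply/polytope_gradingP => t _; exact: coefm_0.
move=> a f g; rewrite !inE => /polytope_gradingP fh /polytope_gradingP gh.
apply/polytope_gradingP => t th.
by rewrite coefm_linear fh ?gh ?mulr0 ?addr0.
Qed.

Lemma polytope_grading_mul i j (f g : kP) : polytope_grading k P i f ->
  polytope_grading k P j g -> polytope_grading k P (i + j) (f * g).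
Proof.
move=> fi gj; apply/polytope_gradingP => t tij.
rewrite /coefm mcoeffMl big_seq big1 // => s sf.
rewrite big_seq big1 // => s' s'g; case: eqP => //= ss'.
case/eqP: tij; rewrite -ss' last_coordD PoszD.
by rewrite (fi s) ?(gj s') ?mcoeff_neq0.
Qed.

Lemma polytope_grading_mono t h :
  last_coord t = h%:Z -> polytope_grading k P h (mono t).
Proof.
move=> th s; rewrite [_@__]coefm_mono; case: (t =P s) => [<- _|_]; first exact: th.
by rewrite eqxx.
Qed.

End PolytopeAlgebra.

(* The algebra inherits its structures along several definitionally equal paths,
   and comparing two of them by unfolding the algebra does not end in practice.
   From here on only the lemmas above are used. *)
Opaque polytope_algebra mono coefm.

(** * Lattice points of polytopes *)

Section LatticePoints.
Variables (R : realType) (n : nat).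
Implicit Types (P : set 'rV[R]_n) (y : 'rV[int]_n).

Definition hull m (v : 'I_m -> 'rV[int]_n) : set 'rV[R]_n :=
  [set x | exists w : 'I_m -> R,
     [/\ forall i, 0 <= w i, \sum_i w i = 1 &
         x = \sum_i w i *: lattice_vec R (v i)]].

Lemma hull_vertex m (v : 'I_m -> 'rV[int]_n) i : lattice_points (hull v) (v i).
Proof.
exists (fun j => (j == i)%:R); split=> [j||]; first exact: ler0n.
  by rewrite (bigD1 i) //= eqxx big1 ?addr0 // => j /negPf->.
rewrite (bigD1 i) //= eqxx scale1r big1 ?addr0 // => j /negPf->.
by rewrite scale0r.
Qed.

Lemma hull_sub P m (v : 'I_m -> 'rV[int]_n) : lattice_polytope P ->
  (forall i, lattice_points P (v i)) -> hull v `<=` P.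
Proof.
case=> q [u ->] Pv x [w [w_ge0 w_sum ->]].
have [c cP] := choice Pv.
exists (fun j => \sum_i w i * c i j); split=> [j||].
- by apply: sumr_ge0 => i _; apply: mulr_ge0; rewrite ?w_ge0 //; case: (cP i).
- rewrite exchange_big /= -[RHS]w_sum; apply: eq_bigr => i _.
  by have [_ c1 _] := cP i; rewrite -mulr_sumr c1 mulr1.
under eq_bigr => i _.
  have [_ _ ->] := cP i; rewrite scaler_sumr.
  under eq_bigr do rewrite scalerA.
over.
by rewrite exchange_big /=; apply: eq_bigr => j _; rewrite scaler_suml.
Qed.

Lemma lattice_points_bounded P : lattice_polytope P ->
  exists K : nat, forall y j, lattice_points P y -> (`|y ord0 j| <= K)%N.
Proof.
case=> m [v ->]; exists (\sum_i \sum_j `|v i ord0 j|)%N => y j [w [w_ge0 w_sum yE]].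
have /rowP/(_ j) := yE; rewrite mxE summxE => yjE.
rewrite -lez_nat abszE -(ler_int R) intr_norm yjE.
apply: le_trans (ler_norm_sum _ _ _) _.
rewrite [leRHS]natr_sum; apply: ler_sum => i _.
rewrite !mxE normrM ger0_norm // -intr_norm -abszE.
apply: le_trans (_ : 1 * `|v i ord0 j|%N%:R <= _).
  apply: ler_wpM2r; first exact: ler0n.
  by rewrite -w_sum (bigD1 i) //= lerDl sumr_ge0.
by rewrite mul1r ler_nat (bigD1 j) //= leq_addr.
Qed.

(** The lattice points lie in a cube, whose points are listed as the rows with
    entries in ['I_(K + K).+1], shifted by [K]. *)
Lemma lattice_points_finite P : lattice_polytope P ->
  exists N (x : 'I_N -> 'rV[int]_n),
    injective x /\ forall y, lattice_points P y <-> exists i, y = x i.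
Proof.
move=> /lattice_points_bounded[K PK].
pose box (M : 'rV['I_(K + K).+1]_n) : 'rV[int]_n :=
  map_mx (fun a : 'I_(K + K).+1 => (a : nat)%:Z - K%:Z) M.
pose s := undup [seq y <- map box (enum [set: 'rV['I_(K + K).+1]_n]%SET)
                 | `[< lattice_points P y >]].
have sP y : (y \in s) <-> lattice_points P y.
  rewrite mem_undup mem_filter; split; first by case/andP=> /asboolP.
  move=> Py; apply/andP; split; first exact/asboolP.
  apply/mapP; exists (map_mx (fun a : int => inord `|a + K%:Z|) y).
    by rewrite mem_enum inE.
  apply/rowP => j; rewrite !mxE.
  have := PK y j Py; rewrite -lez_nat abszE ler_norml => /andP[y_ge y_le].
  have yK : 0 <= y 0 j + K%:Z by rewrite -(opprK K%:Z) subr_ge0.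
  rewrite inordK; first by rewrite gez0_abs // addrK.
  by rewrite ltnS -lez_nat gez0_abs // PoszD lerD2r.
exists (size s), (fun i => nth 0 s i); split.
  by move=> i j /eqP; rewrite nth_uniq ?undup_uniq // => /eqP/val_inj.
move=> y; rewrite -sP; split=> [ys|[i ->]]; last exact: mem_nth.
have ys' := ys; rewrite -index_mem in ys'.
by exists (Ordinal ys'); rewrite nth_index.
Qed.

Lemma rational_combination_int m (c : 'I_m -> rat) :
  exists N (z : 'I_m -> int), (0 < N)%N /\ forall i, N%:R * c i = (z i)%:~R.
Proof.
exists `|(\prod_i denq (c i))%R|%N.
exists (fun i => numq (c i) * \prod_(j | j != i) denq (c j)); split=> [|i].
  by rewrite absz_gt0; apply/prodf_neq0 => i _; apply: denq_neq0.
have -> : (`|(\prod_i denq (c i))%R|%N)%:R = (\prod_i denq (c i))%:~R :> rat.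
  by rewrite -[LHS]/((Posz _)%:~R) gez0_abs // prodr_ge0.
rewrite (bigD1 i) //= !intrM mulrC mulrA -numqE.
by rewrite [(numq _)%:~R]numqE.
Qed.

(** A lattice point of a hull is a real combination of the vertices, so it is
    also a rational one, since linear systems with rational coefficients that
    are solvable over the reals are solvable over the rationals.  The rational
    coefficients may be negative; the corresponding terms are moved to the side
    of [y], which is enough to apply the defining property of a face. *)
Lemma hull_integer_relation m (v : 'I_m -> 'rV[int]_n) y :
  lattice_points (hull v) y ->
  exists N (a b : 'I_m -> nat), (0 < N)%N /\
    row_mx y (const_mx 1) *+ N + \sum_i row_mx (v i) (const_mx 1) *+ b i =
    \sum_i row_mx (v i) (const_mx 1) *+ a i :> 'rV[int]_(n + 1).
Proof.
case=> w [_ w_sum yE].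
pose l (x : 'rV[int]_n) : 'rV[int]_(n + 1) := row_mx x (const_mx 1).
pose M : 'M[rat]_(m, n + 1) := \matrix_i map_mx intr (l (v i)).
have : (map_mx intr (l y) <= M)%MS.
  rewrite -(map_submx (ratr : {rmorphism rat -> R})).
  apply/submxP; exists (\row_i w i); apply/rowP => j.
  have ME i : (map_mx ratr M : 'M[R]_(m, n + 1)) i j = (l (v i) 0 j)%:~R.
    by rewrite [LHS]mxE [M i j]mxE [X in ratr X]mxE ratr_int.
  have -> : (map_mx ratr (map_mx intr (l y)) : 'rV[R]_(n + 1)) 0 j
            = (l y 0 j)%:~R.
    by rewrite [LHS]mxE [X in ratr X]mxE ratr_int.
  rewrite [RHS]mxE; under eq_bigr => i _ do rewrite [X in X * _]mxE ME.
  rewrite -(splitK j); case: (split j) => j' /=; last first.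
    under eq_bigr do rewrite row_mxEr mxE mulr1.
    by rewrite w_sum row_mxEr mxE.
  have /rowP/(_ j') := yE; rewrite mxE summxE row_mxEl => ->.
  by apply: eq_bigr => i _; rewrite row_mxEl !mxE.
case/submxP=> c cE; have [N [z [N_gt0 zE]]] := rational_combination_int (c 0).
exists N, (fun i => if 0 <= z i then `|z i|%N else 0%N).
exists (fun i => if 0 <= z i then 0%N else `|z i|%N); split=> //.
have {}cE : l y *+ N = \sum_i l (v i) *~ z i.
  apply/rowP => j; apply: (@intr_inj rat).
  have lyE : (l y 0 j)%:~R = \sum_i c 0 i * (l (v i) 0 j)%:~R :> rat.
    have /rowP/(_ j) := cE; rewrite [LHS]mxE [RHS]mxE => ->.
    by apply: eq_bigr => i _; rewrite [M i j]mxE [X in _ * X = _]mxE.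
  rewrite -scaler_nat [X in X%:~R = _]mxE intrM lyE mulr_sumr summxE rmorph_sum.
  apply: eq_bigr => i _; rewrite -scaler_int [X in _ = X%:~R]mxE intrM.
  by rewrite mulrA -[(_%:R)%:~R]/(N%:R%:~R) rmorph_nat zE intz.
apply/eqP; rewrite -subr_eq0 -addrA -sumrB cE -big_split /=; apply/eqP.
rewrite big1 // => i _; case: ifP => [z_ge0|z_lt0].
  by rewrite mulr0n sub0r -{1}[z i]gez0_abs // subrr.
rewrite mulr0n subr0.
have zE' : z i = - (`|z i|%N)%:Z by rewrite ltz0_abs ?opprK // ltNge z_lt0.
by rewrite {1}zE' mulrNz addNr.
Qed.

End LatticePoints.

(** * Graded endomorphisms *)

Section GradedEndomorphisms.
Variables (R : realType) (n : nat) (k : fieldType) (P : set 'rV[R]_n).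
Hypothesis polyP : lattice_polytope P.
Local Notation kP := (polytope_algebra k P).
Implicit Types (s t : semigroup P).

Lemma last_coord_nat t : exists h : nat, last_coord t = h%:Z.
Proof.
exists `|last_coord t|%N; rewrite gez0_abs //.
by case/orP: (sg_last_coord t) => [/ltW //|/eqP t0]; rewrite /last_coord t0 mxE.
Qed.

(** Every semigroup element is a sum of generators, as many as its degree. *)
Lemma finite_degree h : exists s : seq (semigroup P),
  uniq s /\ forall t, (t \in s) = (last_coord t == h%:Z).
Proof.
have [N [x [_ xP]]] := lattice_points_finite polyP.
pose step (s : seq (semigroup P)) :=
  [seq sg_add (pt P (x i)) t | i <- enum 'I_N, t <- s].
pose deg m := iter m step [:: sg_zero P].
suff degP t m : last_coord t = m%:Z -> t \in deg m.
  exists (undup [seq t : semigroup P <- deg h | last_coord t == h%:Z]); split=> [|t].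
    exact: undup_uniq.
  by rewrite mem_undup mem_filter; case: eqP => //= /degP.
suff [m' tm' mm'] : exists2 m', t \in deg m' & last_coord t = m'%:Z.
  by rewrite mm' => -[<-].
elim/semigroup_ind: t => [|s t [a sa aE] [b tb bE]|y /xP[i yE]].
- by exists 0%N; rewrite ?inE //= /last_coord mxE.
- exists (a + b)%N; last by rewrite last_coordD aE bE PoszD.
  elim: a s {aE} sa => [s|a IHa s]; first by rewrite inE => /eqP->; rewrite sg_add0.
  case/allpairsP=> -[i s'] [/= _ s'a ->]; rewrite -sg_addA.
  by apply/allpairsP; exists (i, sg_add s' t); rewrite mem_enum; split=> //; apply: IHa.
- exists 1%N; last by rewrite last_coord_pt //; apply/xP; exists i.
  apply/allpairsP; exists (i, sg_zero P); rewrite mem_enum; split=> //=.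
    by rewrite inE.
  by rewrite yE; apply: esym; exact: sg_addr0.
Qed.

(** The homogeneous components are finite dimensional, so surjectivity implies
    injectivity degree by degree.  On the component of degree [h] the map is
    given by the square matrix [e], and preimages of the monomials provide a
    left inverse of it. *)
Lemma graded_surj_inj (E : {linear kP -> kP}) :
  (forall t h, last_coord t = h%:Z -> polytope_grading k P h (E (mono k t))) ->
  (forall t, exists f, E f = mono k t) -> forall f, E f = 0 -> f = 0.
Proof.
move=> E_gr E_surj f Ef0; apply: coefm_inj => t0; rewrite coefm_0.
have [h t0h] := last_coord_nat t0; have [s [s_uniq sP]] := finite_degree h.
pose tt (i : 'I_(size s)) := nth (sg_zero P) s i.
have ttP t : reflect (exists i, t = tt i) (last_coord t == h%:Z).
  rewrite -sP; apply: (iffP idP) => [ts|[i ->]]; last exact: mem_nth.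
  have ts' := ts; rewrite -index_mem in ts'.
  by exists (Ordinal ts'); rewrite /tt nth_index.
have tt_inj i j : (tt i == tt j) = (i == j) by rewrite nth_uniq.
pose e := \matrix_(i, j) coefm (tt j) (E (mono k (tt i))).
pose coefs (g : kP) := \row_i coefm (tt i) g.
have coefsX i : coefs (mono k (tt i)) = delta_mx 0 i.
  by apply/rowP => j; rewrite !mxE coefm_mono tt_inj eq_sym.
have coefsE (g : kP) : coefs (E g) = coefs g *m e.
  have coefsL a (u v : kP) : coefs (a *: u + v) = a *: coefs u + coefs v.
    by apply/rowP => j; rewrite !mxE coefm_linear.
  have coefs0 : coefs 0 = 0 by apply/rowP => j; rewrite !mxE coefm_0.
  elim/polytope_algebra_ind: g => [|a t u IHu].
    by rewrite linear0 coefs0 mul0mx.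
  rewrite linearP !coefsL IHu mulmxDl -scalemxAl; congr (_ *: _ + _).
  have [/ttP[i ->]|th] := boolP (last_coord t == h%:Z).
    by rewrite coefsX -rowE; apply/rowP => j; rewrite !mxE.
  have -> : coefs (mono k t) = 0.
    apply/rowP => j; rewrite !mxE coefm_mono; case: eqP => // tj.
    by case/ttP: th; exists j.
  rewrite mul0mx; apply/rowP => j; rewrite !mxE.
  have [m tm] := last_coord_nat t; have /polytope_gradingP := E_gr t m tm; apply.
  have /eqP -> : last_coord (tt j) == h%:Z by apply/ttP; exists j.
  by rewrite -tm eq_sym.
have [g gE] := choice (fun i => E_surj (tt i)).
have ge1 : (\matrix_i coefs (g i)) *m e = 1%:M.
  by apply/row_matrixP => i; rewrite row_mul rowK -coefsE gE coefsX row1.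
have [_ e_unit] := mulmx1_unit ge1.
have : coefs f *m e = 0.
  by rewrite -coefsE Ef0; apply/rowP => j; rewrite !mxE coefm_0.
move/(congr1 (mulmx^~ (invmx e))); rewrite mulmxK // mul0mx => f0.
have [i ->] : exists i, t0 = tt i by apply/ttP; rewrite t0h.
by have /rowP/(_ i) := f0; rewrite !mxE.
Qed.

End GradedEndomorphisms.

(** * Rescaling a standard graded algebra *)

Section Regrading.
Variables (k : fieldType) (A C : comAlgType k) (gA : nat -> set A).
Hypothesis stdA : standard_graded gA.

Lemma standard_degree0_alg (a : k) : gA 0%N a%:A.
Proof. by rewrite (standard_degree0 stdA); exists a. Qed.

Lemma scalar_of_degree0 a : gA 0%N a -> exists c : k, a = c%:A.
Proof. by rewrite (standard_degree0 stdA) => -[c _ <-]; exists c. Qed.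

Lemma homogeneous_submod h : GRing.submod_closed [in gA h].
Proof. exact: (graded_submod stdA). Qed.

Lemma homogeneous0 h : gA h 0.
Proof. by have [] := homogeneous_submod h; rewrite inE. Qed.

Lemma homogeneous_linear h c (a b : A) : gA h a -> gA h b -> gA h (c *: a + b).
Proof.
move=> ga gb; have [_ /(_ c a b)] := homogeneous_submod h.
by rewrite !inE; apply.
Qed.

Lemma homogeneousD h (a b : A) : gA h a -> gA h b -> gA h (a + b).
Proof. by move=> ga gb; rewrite -[a]scale1r; apply: homogeneous_linear. Qed.

Lemma homogeneousZ h c (a : A) : gA h a -> gA h (c *: a).
Proof.
move=> ga; rewrite -[_ *: _]addr0; apply: homogeneous_linear => //.
exact: homogeneous0.
Qed.

Lemma homogeneous_sum (I : Type) (r : seq I) h (F : I -> A) :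
  (forall i, gA h (F i)) -> gA h (\sum_(i <- r) F i).
Proof.
move=> gF; elim/big_ind: _ => //; first exact: homogeneous0.
exact: homogeneousD.
Qed.

(** The homogeneous components of [a] are stored as the coefficients of a
    polynomial: by uniqueness of the components this turns products of elements
    into products of polynomials. *)
Definition component_poly (a : A) (p : {poly A}) :=
  p.[1] = a /\ forall i, gA i p`_i.

Lemma component_poly_exists a : exists p, component_poly a p.
Proof.
have [m [c [gc ->]]] := graded_span stdA a.
exists (\poly_(i < m) c i); split=> [|i]; last first.
  by rewrite coef_poly; case: ifP => _ //; apply: homogeneous0.
by rewrite horner_poly; apply: eq_bigr => i _; rewrite expr1n mulr1.
Qed.

Lemma component_poly_uniq a p q :
  component_poly a p -> component_poly a q -> p = q.
Proof.
move=> [pa gp] [qa gq]; apply/eqP; rewrite -subr_eq0; apply/eqP/polyP => i.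
rewrite coef0; have [i_lt|/leq_sizeP->//] := ltnP i (size (p - q)).
apply: (graded_direct stdA (n := size (p - q)) (c := fun i => (p - q)`_i)) => // [j|].
  by rewrite coefB -scaleN1r addrC; apply: homogeneous_linear.
have := hornerD p (- q) 1; rewrite hornerN pa qa subrr horner_coef => e.
rewrite -[RHS]e.
by apply: eq_bigr => j _; rewrite expr1n mulr1.
Qed.

(** The one-parameter scaling of a graded algebra, followed by [f].  For [y = 0] it
    is the projection onto the component of degree 0. *)
Lemma regrading (f : {lrmorphism A -> C}) (y : C) :
  exists g : {lrmorphism A -> C}, forall h a, gA h a -> g a = y ^+ h * f a.
Proof.
have [p pP] := choice component_poly_exists.
have p_lin : forall c a b, p (c *: a + b) = (c%:A)%:P * p a + p b.
  move=> c a b; apply: component_poly_uniq (pP _) _; split=> [|i].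
    by rewrite hornerD hornerM hornerC !(proj1 (pP _)) mulr_algl.
  rewrite coefD coefCM mulr_algl; apply: homogeneous_linear; exact: (proj2 (pP _)).
have p_mul : forall a b, p (a * b) = p a * p b.
  move=> a b; apply: component_poly_uniq (pP _) _; split=> [|i].
    by rewrite hornerM !(proj1 (pP _)).
  rewrite coefM; apply: homogeneous_sum => j.
  rewrite -[X in gA X](subnKC (ltn_ord j : j <= i)%N).
  by apply: (graded_mul stdA); apply: (proj2 (pP _)).
have p_hom h a : gA h a -> p a = a%:P * 'X^h.
  move=> ga; apply: component_poly_uniq (pP _) _; split=> [|i].
    by rewrite hornerM hornerC hornerXn expr1n mulr1.
  rewrite coefCM coefXn; case: eqP => [->|_]; rewrite ?mulr1 ?mulr0 //.
  exact: homogeneous0.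
pose g a := (map_poly f (p a)).[y].
have g_lin : linear g.
  move=> c a b; rewrite /g p_lin rmorphD rmorphM hornerD hornerM /=.
  by rewrite map_polyC hornerC /= rmorph_alg mulr_algl.
have g_mul : monoid_morphism g.
  split=> [|a b]; last by rewrite /g p_mul rmorphM hornerM.
  have g1 : gA 0%N 1 by rewrite -[1]scale1r; apply: standard_degree0_alg.
  by rewrite /g (p_hom _ _ g1) expr0 mulr1 rmorph1 hornerC.
have [g' g'E] := lrmorphism_exists g_lin g_mul.
exists g' => h a /p_hom pa; rewrite g'E /g pa rmorphM hornerM /=.
by rewrite map_polyC map_polyXn hornerC hornerXn mulrC.
Qed.

End Regrading.

(** * Tensor products of graded algebras *)

Section Tensor.
Variables (k : fieldType) (A B AB : comAlgType k).
Variables (tens : {bilinear A -> B -> AB}) (tensAB : is_tensor_product tens).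

Lemma tensor_linear_eq (V : lmodType k) (g g' : AB -> V) :
  linear g -> linear g' ->
  (forall a b, g (tens a b) = g' (tens a b)) -> g =1 g'.
Proof.
move=> g_lin g'_lin gg'.
pose gL : {linear AB -> V} := HB.pack g (GRing.isLinear.Build k AB V *:%R g g_lin).
pose gL' : {linear AB -> V} := HB.pack g' (GRing.isLinear.Build k AB V *:%R g' g'_lin).
have [||b bE] := @bilinear_exists k A B V (fun a b => g (tens a b)).
- by move=> y c x x'; rewrite linearPl; apply: g_lin.
- by move=> x c y y'; rewrite linearPr; apply: g_lin.
have [g0 _ g0_uniq] := tensor_universal tensAB b.
move=> z; transitivity (g0 z); first by apply: (g0_uniq gL) => x y; rewrite bE.
by apply/esym; apply: (g0_uniq gL') => x y; rewrite bE gg'.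
Qed.

Lemma tensor_lrmorphism (C : comAlgType k) (f : {lrmorphism A -> C})
    (g : {lrmorphism B -> C}) :
  exists h : {lrmorphism AB -> C}, forall a b, h (tens a b) = f a * g b.
Proof.
have [||b bE] := @bilinear_exists k A B C (fun a b => f a * g b).
- by move=> y c x x'; rewrite linearP mulrDl scalerAl.
- by move=> x c y y'; rewrite linearP mulrDr scalerAr.
have [h hE _] := tensor_universal tensAB b.
have {b bE}hE x y : h (tens x y) = f x * g y by rewrite hE bE.
have h_mul : monoid_morphism h.
  split=> [|x y]; first by rewrite -(tensor_one tensAB) hE !rmorph1 mulr1.
  have lin1 (D : comAlgType k) (v : D) (e : {linear AB -> D}) :
      linear (fun u => e u * v).
    by move=> c u u'; rewrite linearP mulrDl scalerAl.
  apply: (@tensor_linear_eq C (fun x => h (x * y)) (fun x => h x * h y)) x.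
  - by move=> c u u'; rewrite mulrDl -scalerAl linearP.
  - exact: lin1.
  move=> a b; rewrite mulrC [RHS]mulrC.
  apply: (@tensor_linear_eq C (fun y => h (y * tens a b))
    (fun y => h y * h (tens a b))) y.
  - by move=> c u u'; rewrite mulrDl -scalerAl linearP.
  - exact: lin1.
  by move=> a' b'; rewrite (tensor_mul tensAB) !hE !rmorphM mulrACA.
have [h' h'E] := @lrmorphism_exists k AB C h (linearP h) h_mul.
by exists h' => a b; rewrite h'E hE.
Qed.

Lemma tensor_inl : exists f : {lrmorphism A -> AB}, forall a, f a = tens a 1.
Proof.
have f_lin : linear (tens^~ 1) by move=> c x y; rewrite linearPl.
have f_mul : monoid_morphism (tens^~ 1).
  split=> [|x y]; first exact: tensor_one tensAB.
  by rewrite (tensor_mul tensAB) mulr1.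
by have [f fE] := lrmorphism_exists f_lin f_mul; exists f.
Qed.

Lemma tensor_inr : exists f : {lrmorphism B -> AB}, forall b, f b = tens 1 b.
Proof.
have f_lin : linear (tens 1) by move=> c x y; rewrite linearPr.
have f_mul : monoid_morphism (tens 1).
  split=> [|x y]; first exact: tensor_one tensAB.
  by rewrite (tensor_mul tensAB) mulr1.
by have [f fE] := lrmorphism_exists f_lin f_mul; exists f.
Qed.

(** Contracting one factor with a linear functional recovers the other factor. *)
Lemma tensor_contractl (m : B -> k) : linear_for *%R m ->
  exists g : {linear AB -> A}, forall a b, g (tens a b) = m b *: a.
Proof.
move=> m_lin.
have [||b bE] := @bilinear_exists k A B A (fun a b => m b *: a).
- by move=> y c x x'; rewrite scalerDr !scalerA mulrC.
- by move=> x c y y'; rewrite m_lin scalerDl scalerA.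
have [g gE _] := tensor_universal tensAB b.
by exists g => x y; rewrite gE bE.
Qed.

Lemma tensor_contractr (m : A -> k) : linear_for *%R m ->
  exists g : {linear AB -> B}, forall a b, g (tens a b) = m a *: b.
Proof.
move=> m_lin.
have [||b bE] := @bilinear_exists k A B B (fun a b => m a *: b).
- by move=> y c x x'; rewrite m_lin scalerDl scalerA.
- by move=> x c y y'; rewrite scalerDr !scalerA mulrC.
have [g gE _] := tensor_universal tensAB b.
by exists g => x y; rewrite gE bE.
Qed.

Variables (gA : nat -> set A) (gB : nat -> set B).
Hypotheses (stdA : standard_graded gA) (stdB : standard_graded gB).

Lemma tens_graded i j a b :
  gA i a -> gB j b -> tensor_grading tens gA gB (i + j) (tens a b).
Proof.
move=> ga gb.
have i_lt : (i < (i + j).+1)%N by rewrite ltnS leq_addr.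
exists (fun l => if l == Ordinal i_lt then tens a b else 0).
  move=> l; case: eqP => [->|_] /=.
    exists 1%N, (fun=> a), (fun=> b); rewrite big_ord1; split=> // _.
    by rewrite addKn.
  by exists 0%N, (fun=> 0), (fun=> 0); rewrite big_ord0; split=> // - [].
by rewrite (bigD1 (Ordinal i_lt)) //= eqxx big1 ?addr0 // => l /negPf->.
Qed.

Lemma tensor_degree1 z : tensor_grading tens gA gB 1 z ->
  exists a b, [/\ gA 1%N a, gB 1%N b & z = tens a 1 + tens 1 b].
Proof.
case=> c cP ->; rewrite big_ord_recl big_ord1.
have [m [u [v [gu gv ->]]]] := cP ord0.
have [m' [u' [v' [gu' gv' ->]]]] := cP (lift ord0 ord0).
have [e eE] := choice (fun l => scalar_of_degree0 stdA (gu l)).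
have [e' e'E] := choice (fun l => scalar_of_degree0 stdB (gv' l)).
exists (\sum_l e' l *: u' l), (\sum_l e l *: v l); split.
- by apply: homogeneous_sum => // l; apply: homogeneousZ => //; apply: gu'.
- by apply: homogeneous_sum => // l; apply: homogeneousZ => //; apply: gv.
rewrite linear_sumlz linear_sumr addrC; congr (_ + _); apply: eq_bigr => l _.
  by rewrite e'E linearZr_LR linearZl_LR.
by rewrite eE linearZr_LR linearZl_LR.
Qed.

End Tensor.

(** * Splittings of a graded algebra *)

Section Splitting.
Variables (k : fieldType) (T : comAlgType k) (gT : nat -> set T).

(** What the proof uses of an isomorphism of the tensor product of [A] and [B]
    with [T].  It is symmetric in [A] and [B], so that the theorem needs to be
    proved for one factor only.  The field [splitting_hom] rescales the two
    factors independently, by arbitrary elements of [T]; [splitting_proportional]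
    is the uniqueness of the factors of a pure tensor. *)
Record graded_splitting (A B : comAlgType k) (gA : nat -> set A)
    (gB : nat -> set B) (f : {lrmorphism A -> T}) (g : {lrmorphism B -> T}) :
    Prop := GradedSplitting {
  splitting_injl : injective f;
  splitting_injr : injective g;
  splitting_gradedl : forall h a, gA h a -> gT h (f a);
  splitting_gradedr : forall h b, gB h b -> gT h (g b);
  splitting_degree1 : forall u, gT 1 u ->
    exists a b, [/\ gA 1%N a, gB 1%N b & u = f a + g b];
  splitting_hom : forall y z, exists h : {lrmorphism T -> T},
    (forall a, gA 1%N a -> h (f a) = y * f a) /\
    (forall b, gB 1%N b -> h (g b) = z * g b);
  splitting_proportional : forall a a' b b', f a * g b' = f a' * g b ->
    f a' != 0 -> g b' != 0 -> exists c, f a = c *: f a' /\ g b = c *: g b'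
}.

Lemma splitting_sym A B gA gB f g :
  @graded_splitting A B gA gB f g -> graded_splitting gB gA g f.
Proof.
case=> fI gI fG gG deg1 hom prop; split.
- exact: gI.
- exact: fI.
- exact: gG.
- exact: fG.
- move=> u /deg1[a [b [ga gb ->]]]; exists b, a.
  by split; [exact: gb | exact: ga | exact: addrC].
- move=> y z; have [h [hf hg]] := hom z y.
  by exists h; split; [exact: hg | exact: hf].
move=> b b' a a' e b'0 a'0.
have e' : f a * g b' = f a' * g b.
  by rewrite [LHS]mulrC -e mulrC.
by have [c [fE gE]] := prop a a' b b' e' a'0 b'0; exists c.
Qed.

End Splitting.

Section TensorSplitting.
Variables (R : realType) (n : nat) (k : fieldType) (P : set 'rV[R]_n).
Local Notation kP := (polytope_algebra k P).

Lemma scaler_solve (V : lmodType k) (c d : k) (u v : V) :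
  c != 0 -> c *: u = d *: v -> u = (d / c) *: v.
Proof.
by move=> c0 cu; rewrite mulrC -scalerA -cu scalerA mulVf // scale1r.
Qed.

Lemma tensor_splitting (A B : comAlgType k)
    (gA : nat -> set A) (gB : nat -> set B)
    (stdA : standard_graded gA) (stdB : standard_graded gB)
    (AB : comAlgType k) (tens : {bilinear A -> B -> AB})
    (tensAB : is_tensor_product tens) (normP : normal_polytope k P)
    (isoP : graded_iso (tensor_grading tens gA gB) (polytope_grading k P)) :
  exists (f : {lrmorphism A -> kP}) (g : {lrmorphism B -> kP}),
    graded_splitting (polytope_grading k P) gA gB f g.
Proof.
have [phi [phi_bij phi_gr]] := isoP; have phi_inj := bij_inj phi_bij.
have [psi phiK psiK] := inverse_lrmorphism phi_bij.
have [il ilE] := tensor_inl tensAB; have [ir irE] := tensor_inr tensAB.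
have [f fE] : exists f : {lrmorphism A -> kP}, forall a, f a = phi (tens a 1).
  by exists (phi \o il) => a; rewrite /= ilE.
have [g gE] : exists g : {lrmorphism B -> kP}, forall b, g b = phi (tens 1 b).
  by exists (phi \o ir) => b; rewrite /= irE.
have fgE a b : f a * g b = phi (tens a b).
  by rewrite fE gE -rmorphM (tensor_mul tensAB) mulr1 mul1r.
have g0A : gA 0%N 1 by rewrite -[1]scale1r; apply: standard_degree0_alg.
have g0B : gB 0%N 1 by rewrite -[1]scale1r; apply: standard_degree0_alg.
have coef_lin (D : comAlgType k) (e : {lrmorphism D -> kP}) t :
    linear_for *%R (fun d => coefm t (e d)).
  by move=> c d d'; rewrite linearP coefm_linear.
exists f, g; split.
- have [h hE] := tensor_contractl tensAB (coef_lin B g (sg_zero P)).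
  move=> a a'; rewrite !fE => /phi_inj/(congr1 h).
  by rewrite !hE rmorph1 coefm_1 !scale1r.
- have [h hE] := tensor_contractr tensAB (coef_lin A f (sg_zero P)).
  move=> b b'; rewrite !gE => /phi_inj/(congr1 h).
  by rewrite !hE rmorph1 coefm_1 !scale1r.
- move=> h a ga; rewrite fE; apply/phi_gr.
  by rewrite -[h]addn0; apply: tens_graded.
- move=> h b gb; rewrite gE; apply/phi_gr.
  by rewrite -[h]add0n; apply: tens_graded.
- move=> u; rewrite -(psiK u) => /phi_gr/(tensor_degree1 stdA stdB).
  by case=> [a [b [ga gb ->]]]; exists a, b; rewrite rmorphD /= -fE -gE.
- move=> y z.
  have [fy fyE] := regrading stdA f y; have [gz gzE] := regrading stdB g z.
  have [T TE] := tensor_lrmorphism tensAB fy gz.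
  exists (T \o psi); split=> [a ga|b gb] /=.
    by rewrite fE phiK TE (rmorph1 gz) mulr1 (fyE _ _ ga) expr1 fE.
  by rewrite gE phiK TE (rmorph1 fy) mul1r (gzE _ _ gb) expr1 gE.
move=> a a' b b' e a'0 b'0.
(* Contract with a coefficient functional that does not vanish at [b']. *)
have [t b't] : exists t, coefm t (g b') != 0.
  apply: contrapT => no_t; case/eqP: b'0; apply: coefm_inj => t; rewrite coefm_0.
  by apply/eqP/negPn/negP => b't; apply: no_t; exists t.
have [h hE] := tensor_contractl tensAB (coef_lin B g t).
pose c := coefm t (g b) / coefm t (g b').
have aE : a = c *: a'.
  have : h (tens a b') = h (tens a' b).
    by congr (h _); apply: phi_inj; rewrite -!fgE.
  by rewrite !hE; apply: scaler_solve.
exists c; split; first by rewrite aE linearZ.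
have : f a' * (g b - c *: g b') = 0.
  by rewrite mulrBr -e aE linearZ /= -scalerAl -scalerAr subrr.
case/(normal_polytope_mulf_eq0 normP) => [/eqP|/eqP]; first by rewrite (negPf a'0).
by rewrite subr_eq0 => /eqP.
Qed.

End TensorSplitting.

(** * The component of degree 1 *)

(** If the members of a free family [e] are split as [v i + w i] by a projection
    [T], then the index set can be partitioned in such a way that the [v i] with [i]
    in [I] span all the [v j] and the [w i] with [i] outside [I] span all the
    [w j].  In coordinates [T] is an idempotent matrix [p]; choose the rows of an
    invertible matrix [M] among those of [p] and of [1 - p].  Multiplying [M] by
    [p] keeps the rows of the first kind and kills the others, so the inverse of
    [M] expresses all the rows of [p] through the chosen ones. *)
Lemma split_basis (F : fieldType) (V : lmodType F) N (e v w : 'I_N -> V)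
    (T : {linear V -> V}) (p : 'M[F]_N) :
  (forall c : 'I_N -> F, \sum_i c i *: e i = 0 -> forall i, c i = 0) ->
  (forall i, e i = v i + w i) -> (forall i, v i = \sum_j p i j *: e j) ->
  (forall i, T (v i) = v i) -> (forall i, T (w i) = 0) ->
  exists (I : {set 'I_N}) (C : 'M[F]_N),
    [/\ forall i, i \in I -> v i != 0, forall i, i \notin I -> w i != 0,
        forall j, v j = \sum_(l in I) C j l *: v l &
        forall j, w j = \sum_(l | l \notin I) C j l *: w l].
Proof.
move=> e_free e_vw v_p Tv Tw.
have wE i : w i = \sum_j (1%:M - p) i j *: e j.
  under eq_bigr do rewrite !mxE scalerBl.
  rewrite sumrB -v_p (bigD1 i) //= eqxx scale1r big1 ?addr0 => [|j ji].
    by rewrite e_vw addrC addKr.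
  by rewrite eq_sym (negPf ji) scale0r.
have Te i : T (e i) = v i by rewrite e_vw linearD /= Tv Tw addr0.
have pp : p *m p = p.
  apply/matrixP => i j; apply/eqP; rewrite -subr_eq0; apply/eqP.
  apply: (e_free (fun j => (p *m p) i j - p i j)).
  under eq_bigr do rewrite scalerBl.
  rewrite sumrB -v_p -[X in _ - X]Tv v_p linear_sum /=.
  under [X in _ - X]eq_bigr do rewrite linearZ /= Te v_p scaler_sumr.
  rewrite exchange_big /= -sumrB big1 // => l _.
  rewrite mxE scaler_suml -sumrB big1 // => m _.
  by rewrite scalerA subrr.
have [|I Mu] := @mixed_rows_unit F N p (1%:M - p).
  by rewrite addrC subrK unitmx1.
set M := \matrix_i _ in Mu; pose C := invmx M.
have Mp i : row i (M *m p) = if i \in I then row i p else 0.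
  rewrite row_mul rowK; case: ifP => _; rewrite -row_mul ?pp //.
  by rewrite mulmxBl mul1mx pp subrr row0.
have Mq i : row i (M *m (1%:M - p)) = if i \in I then 0 else row i (1%:M - p).
  rewrite row_mul rowK; case: ifP => _; rewrite -row_mul mulmxBr mulmx1.
    by rewrite pp subrr row0.
  by rewrite mulmxBl mul1mx pp subrr subr0.
have combi (q : 'M[F]_N) (D : pred 'I_N) (u : 'I_N -> V) :
    (forall i, u i = \sum_j q i j *: e j) ->
    (forall i, row i (M *m q) = if D i then row i q else 0) ->
    forall j, u j = \sum_(l | D l) C j l *: u l.
  move=> uE MqE j; rewrite uE; under [RHS]eq_bigr do rewrite uE scaler_sumr.
  rewrite exchange_big /=; apply: eq_bigr => m _.
  under eq_bigr do rewrite scalerA.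
  rewrite -scaler_suml; congr (_ *: _).
  rewrite -[q in LHS](mulKmx Mu) mxE [RHS]big_mkcond /=; apply: eq_bigr => l _.
  have /rowP/(_ m) := MqE l; rewrite mxE => ->; case: ifP => _.
    by rewrite mxE.
  by rewrite mxE mulr0.
have M_row i : row i M != 0.
  apply/eqP => Mi0; have : row i (M *m invmx M) = 0 by rewrite row_mul Mi0 mul0mx.
  rewrite mulmxV // row1 => /rowP/(_ i); rewrite !mxE !eqxx => /eqP.
  by rewrite oner_eq0.
have nz (q : 'M[F]_N) (u : 'I_N -> V) i :
    (forall i, u i = \sum_j q i j *: e j) -> row i q != 0 -> u i != 0.
  move=> uE; apply: contraNneq; rewrite uE => /e_free q0.
  by apply/eqP/rowP => j; rewrite mxE q0 mxE.
exists I, C; split.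
- by move=> i iI; apply: (nz p) => //; have := M_row i; rewrite rowK iI.
- move=> i iI; apply: (nz (1%:M - p)) => //.
  by have := M_row i; rewrite rowK (negPf iI).
- exact: (combi p).
- by apply: (combi (1%:M - p)) => // i; rewrite Mq; case: ifP.
Qed.

Section Degree1.
Variables (R : realType) (n : nat) (k : fieldType) (P : set 'rV[R]_n).
Local Notation kP := (polytope_algebra k P).
Implicit Types (s t : semigroup P).

Lemma degree0_zero t : last_coord t = 0 -> t = sg_zero P.
Proof.
move=> t0; have := sg_last_coord t; rewrite t0 ltxx => /eqP t_eq0.
exact: val_inj.
Qed.

Lemma degree1_pt t : last_coord t = 1 ->
  exists y, lattice_points P y /\ t = pt P y.
Proof.
elim/semigroup_ind: t => [|s t IHs IHt|y Py _].
- by rewrite /last_coord mxE.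
- have [a sa] := last_coord_nat s; have [b tb] := last_coord_nat t.
  rewrite last_coordD sa tb -PoszD => -[].
  case: a sa => [|a] sa.
    by rewrite (degree0_zero sa) sg_add0 => b1; apply: IHt; rewrite tb -[b]add0n b1.
  case: b tb => [|b] tb; last by rewrite addnS.
  rewrite addn0 => a1; have /IHs[y [Py sE]] : last_coord s = 1 by rewrite sa a1.
  by exists y; split=> //; rewrite (degree0_zero tb) sE; apply: sg_addr0.
- by exists y.
Qed.

Lemma linear_homogeneous (V : lmodType k) (F : {linear kP -> V}) (G : set V) h :
  GRing.submod_closed [in G] ->
  (forall t, last_coord t = h%:Z -> G (F (mono k t))) ->
  forall u, polytope_grading k P h u -> G (F u).
Proof.
move=> [G0 Glin] FX u /polytope_gradingP uh; rewrite inE in G0.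
have [s ->] := mono_expansion u; rewrite linear_sum /=.
elim/big_rec: _ => // t v _ Gv; rewrite linearZ /=.
have [/eqP th|th] := boolP (last_coord t == h%:Z).
  have := Glin (coefm t u) (F (mono k t)) v; rewrite !inE; apply=> //.
  exact: FX.
by rewrite (uh t th) scale0r add0r.
Qed.

Variables (N : nat) (x : 'I_N -> 'rV[int]_n).
Hypotheses (x_inj : injective x)
  (xP : forall y, lattice_points P y <-> exists i, y = x i).

Lemma enum_lattice_point i : lattice_points P (x i).
Proof. by apply/xP; exists i. Qed.

Lemma pt_enum_eq i j : (pt P (x i) == pt P (x j)) = (i == j).
Proof.
apply/eqP/eqP => [/(congr1 (@semigroup_val _ _ _))|->//].
rewrite !val_pt; try exact: enum_lattice_point.
by move/eq_row_mx => [/x_inj].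
Qed.

Lemma degree1_free (c : 'I_N -> k) :
  \sum_i c i *: mono k (pt P (x i)) = 0 -> forall i, c i = 0.
Proof.
move=> c0 i; have := coefm_0 k (pt P (x i)); rewrite -[X in coefm _ X]c0.
rewrite coefm_sum (bigD1 i) //= big1 ?addr0 => [|j ji].
  by rewrite coefm_mono eqxx mulr1.
by rewrite coefm_mono pt_enum_eq (negPf ji) mulr0.
Qed.

Lemma degree1_span u : polytope_grading k P 1 u ->
  exists c : 'I_N -> k, u = \sum_i c i *: mono k (pt P (x i)).
Proof.
pose G : set kP := [set u |
  exists c : 'I_N -> k, u = \sum_i c i *: mono k (pt P (x i))].
apply: (@linear_homogeneous kP idfun G).
  split; rewrite ?inE.
    by exists (fun=> 0); rewrite big1 // => i _; rewrite scale0r.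
  move=> a u1 u2; rewrite !inE => -[c1 ->] [c2 ->].
  exists (fun i => a * c1 i + c2 i); rewrite scaler_sumr -big_split /=.
  by apply: eq_bigr => i _; rewrite scalerA scalerDl.
move=> t /degree1_pt[y [/xP[i ->] ->]].
exists (fun j => (j == i)%:R); rewrite (bigD1 i) //= eqxx scale1r big1 ?addr0 //.
by move=> j /negPf->; rewrite scale0r.
Qed.

End Degree1.

(** * Faces *)

(** A face of the semigroup is given as a predicate [face] for which a sum
    belongs to the face exactly if both summands do; [I] is the set of
    the lattice points on it. *)
Section Face.
Variables (R : realType) (n : nat) (k : fieldType) (P : set 'rV[R]_n).
Hypothesis polyP : lattice_polytope P.
Variables (N : nat) (x : 'I_N -> 'rV[int]_n).
Hypothesis xP : forall y, lattice_points P y <-> exists i, y = x i.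
Variable face : semigroup P -> Prop.
Hypothesis face0 : face (sg_zero P).
Hypothesis faceD : forall s t, face (sg_add s t) <-> face s /\ face t.
Variable I : {set 'I_N}.
Hypothesis face_pt : forall i, face (pt P (x i)) <-> i \in I.

Definition face_polytope : set 'rV[R]_n :=
  @hull R n _ (fun l : 'I_#|I| => x (enum_val l)).
Local Notation Q := face_polytope.
Local Notation kP := (polytope_algebra k P).
Local Notation kQ := (polytope_algebra k Q).

Lemma face_polytope_lattice : lattice_polytope Q.
Proof. by exists #|I|, (fun l => x (enum_val l)). Qed.

(** Sums are formed through their values, since the semigroup of a polytope is a
    type of monomials and carries no additive structure. *)
Lemma face_nat_combination m (s : 'I_m -> semigroup P) (c : 'I_m -> nat) :
  exists t, semigroup_val t = \sum_l semigroup_val (s l) *+ c l /\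
    ((forall l, face (s l)) -> face t).
Proof.
elim/big_ind: _ => [|u v [t [tu ft]] [t' [tv ft']]|l _].
- by exists (sg_zero P).
- exists (sg_add t t'); rewrite -tu -tv; split=> // fs.
  by apply/faceD; split; [apply: ft | apply: ft'].
elim: (c l) => [|d [t [tE ft]]]; first by exists (sg_zero P).
exists (sg_add (s l) t); rewrite mulrS -tE; split=> // fs.
by apply/faceD; split; [apply: fs | apply: ft].
Qed.

Lemma face_polytope_vertex i : i \in I -> lattice_points Q (x i).
Proof.
move=> iI; rewrite -(enum_rankK_in iI iI).
exact: (@hull_vertex R n _ (fun l : 'I_#|I| => x (enum_val l))).
Qed.

(** Taking the hull adds no lattice points.  A lattice point [y] of the hull
    satisfies an integer relation whose right hand side is a sum of points of the
    face, while [y] occurs on the left with a positive coefficient. *)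
Lemma face_lattice_pointsP y :
  lattice_points Q y <-> exists2 i, i \in I & y = x i.
Proof.
split=> [Qy|[i iI ->]]; last exact: face_polytope_vertex.
have Pv l : lattice_points P (x (@enum_val _ (mem I) l)).
  by apply/xP; exists (enum_val l).
have Py : lattice_points P y by apply: (hull_sub polyP Pv).
have /xP[i yE] := Py; exists i => //.
have [d [a [b [d_gt0]]]] := hull_integer_relation Qy.
have [t [tE ft]] := face_nat_combination (fun l => pt P (x (enum_val l))) a.
have [u [uE _]] := face_nat_combination (fun l => pt P (x (enum_val l))) b.
have [w [wE _]] := face_nat_combination (fun _ : 'I_1 => pt P y) (fun=> d.-1).
have ptE c : \sum_l semigroup_val (pt P (x (enum_val l))) *+ c l =
    \sum_(l < #|I|) row_mx (x (enum_val l)) (const_mx 1) *+ c l :> 'rV_(n + 1).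
  by apply: eq_bigr => l _; rewrite val_pt.
rewrite -!ptE -tE -uE -(prednK d_gt0) mulrS.
rewrite big_ord1 in wE; rewrite -(val_pt Py) -wE => rel.
have /faceD[/faceD[fy _] _] : face (sg_add (sg_add (pt P y) w) u).
  have -> : sg_add (sg_add (pt P y) w) u = t by apply: val_inj.
  by apply: ft => l; apply/face_pt; apply: enum_valP.
by apply/face_pt; rewrite -yE.
Qed.

Lemma face_semigroup_sub t :
  t \in in_semigroup Q -> t \in in_semigroup P.
Proof.
move=> /asboolP tQ; apply: tQ.
  split=> [|u v]; first exact: sg_zero_subproof.
  by move=> uP vP; exact: (sg_add_subproof (Defs.Semigroup uP) (Defs.Semigroup vP)).
move=> y /face_lattice_pointsP[i _ ->]; apply: lift_in_semigroup.
by apply/xP; exists i.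
Qed.

Lemma face_semigroup t : face t -> semigroup_val t \in in_semigroup Q.
Proof.
elim/semigroup_ind: t => [_|s t IHs IHt|y /xP[i ->] /face_pt iI].
- exact: sg_zero_subproof.
- move=> /faceD[/IHs sQ /IHt tQ].
  exact: (sg_add_subproof (Defs.Semigroup sQ) (Defs.Semigroup tQ)).
rewrite val_pt; last by apply/xP; exists i.
by apply: lift_in_semigroup; apply: face_polytope_vertex.
Qed.

Lemma face_inclusion : exists inc : {lrmorphism kQ -> kP},
  forall i, i \in I -> inc (mono k (pt Q (x i))) = mono k (pt P (x i)).
Proof.
pose j (t : semigroup Q) : semigroup P :=
  Defs.Semigroup (face_semigroup_sub (semigroup_valP t)).
have j0 : mono k (j (sg_zero Q)) = 1.
  by rewrite -mono0; congr mono; apply: val_inj.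
have jD s t : mono k (j (sg_add s t)) = mono k (j s) * mono k (j t).
  by rewrite -monoD; congr mono; apply: val_inj.
have [inc incE] := lrmorphism_of_monoid j0 jD.
exists inc => i iI; rewrite incE; congr mono; apply: val_inj.
rewrite -[LHS]/(semigroup_val (pt Q (x i))) (val_pt (face_polytope_vertex iI)).
exact: esym (val_pt (enum_lattice_point xP i)).
Qed.

(** The monomials outside a face span an ideal, and the quotient by it is the
    algebra of the face. *)
Lemma face_retraction : exists ret : {lrmorphism kP -> kQ},
  [/\ forall i, i \in I -> ret (mono k (pt P (x i))) = mono k (pt Q (x i)),
      forall i, i \notin I -> ret (mono k (pt P (x i))) = 0 &
      forall h u, polytope_grading k P h u -> polytope_grading k Q h (ret u)].
Proof.
pose j (t : semigroup P) : semigroup Q := insubd (sg_zero Q) (semigroup_val t).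
have jE t : face t -> semigroup_val (j t) = semigroup_val t.
  by move=> /face_semigroup tQ; apply: (insubdK _ tQ).
pose r t : kQ := if `[< face t >] then mono k (j t) else 0.
have r0 : r (sg_zero P) = 1.
  rewrite /r (asboolT face0); transitivity (mono k (sg_zero Q)); last exact: mono0.
  by congr mono; apply: val_inj; exact: (jE _ face0).
have rD s t : r (sg_add s t) = r s * r t.
  rewrite /r; case: (asboolP (face s)) => fs; last first.
    by rewrite mul0r asboolF // => /faceD[].
  case: (asboolP (face t)) => ft; last first.
    by rewrite mulr0 asboolF // => /faceD[].
  have fst : face (sg_add s t) by apply/faceD.
  rewrite (asboolT fst); transitivity (mono k (sg_add (j s) (j t))); last exact: monoD.
  congr mono; apply: val_inj.
  rewrite -[LHS]/(semigroup_val (j (sg_add s t))).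
  rewrite -[RHS]/(semigroup_val (j s) + semigroup_val (j t)).
  by rewrite (jE _ fst) (jE _ fs) (jE _ ft).
have [ret retE] := lrmorphism_of_monoid r0 rD.
exists ret; split.
- move=> i iI; rewrite retE /r asboolT; last exact/face_pt.
  congr mono; apply: val_inj.
  rewrite -[LHS]/(semigroup_val (j (pt P (x i)))) (jE _ (proj2 (face_pt i) iI)).
  rewrite -[RHS]/(semigroup_val (pt Q (x i))) (val_pt (face_polytope_vertex iI)).
  exact: val_pt (enum_lattice_point xP i).
- by move=> i iI; rewrite retE /r asboolF // => /face_pt; apply/negP.
move=> h.
have gr (t : semigroup P) : last_coord t = h%:Z ->
    polytope_grading k Q h (ret (mono k t)).
  move=> th; rewrite retE /r; case: asboolP => ft.
    by apply: polytope_grading_mono; rewrite /last_coord (jE _ ft).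
  by have [+ _] := polytope_grading_submod k Q h; rewrite inE.
exact: linear_homogeneous (polytope_grading_submod k Q h) gr.
Qed.

End Face.

(** * The factors of a polytope algebra *)

Lemma graded_inj_reflects (k : fieldType) (A : comAlgType k) (gA : nat -> set A)
    (R : realType) (n : nat) (Q : set 'rV[R]_n)
    (F : {lrmorphism A -> polytope_algebra k Q}) :
  standard_graded gA ->
  (forall h a, gA h a -> polytope_grading k Q h (F a)) ->
  (forall a, F a = 0 -> a = 0) ->
  forall h a, polytope_grading k Q h (F a) -> gA h a.
Proof.
move=> stdA F_gr F_inj h a /polytope_gradingP Fah.
have [p [pa gp]] := component_poly_exists stdA a.
have aE : a = \sum_(j < size p) p`_j.
  by rewrite -pa horner_coef; apply: eq_bigr => j _; rewrite expr1n mulr1.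
have Fp0 (j : 'I_(size p)) : j != h :> nat -> p`_j = 0.
  move=> jh; apply: F_inj; apply: coefm_inj => t; rewrite coefm_0.
  have [/eqP tj|tj] := boolP (last_coord t == (j : nat)%:Z); last first.
    by have /polytope_gradingP := F_gr _ _ (gp j); apply.
  rewrite -(Fah t); last by rewrite tj eqz_nat.
  rewrite aE linear_sum /=.
  under eq_bigr do rewrite -[F _]scale1r.
  rewrite coefm_sum.
  rewrite (bigD1 j) //= mul1r big1 ?addr0 // => l lj.
  have /polytope_gradingP := F_gr _ _ (gp l) => /(_ t) ->; first exact: mulr0.
  by rewrite tj eqz_nat eq_sym.
have -> : a = \sum_(j < size p | j == h :> nat) p`_j.
  rewrite [LHS]aE [RHS]big_mkcond /=; apply: eq_bigr => j _.
  by case: eqP => // /eqP /Fp0.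
elim/big_ind: _ => [|u v|j /eqP <-]; last exact: gp.
  exact: homogeneous0.
exact: homogeneousD.
Qed.

Lemma domain_mul_neq0 (T : comPzRingType) :
  (forall u v : T, u * v = 0 -> u = 0 \/ v = 0) ->
  forall u v : T, u * v != 0 <-> u != 0 /\ v != 0.
Proof.
move=> dom u v; split=> [uv|[u0 v0]]; last first.
  by apply/eqP => /dom[] /eqP; apply/negP.
by split; apply: contraNneq uv => ->; rewrite ?mul0r ?mulr0.
Qed.

Lemma rmorph_mono_neq0 (k : fieldType) (R : realType) (n : nat) (P : set 'rV[R]_n)
    (C : comAlgType k) (h : {lrmorphism polytope_algebra k P -> C}) :
  (forall u v : C, u * v = 0 -> u = 0 \/ v = 0) ->
  forall s t : semigroup P,
  h (mono k (sg_add s t)) != 0 <-> h (mono k s) != 0 /\ h (mono k t) != 0.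
Proof.
move=> dom s t; rewrite monoD rmorphM; exact: domain_mul_neq0.
Qed.

Lemma free_proportional (F : fieldType) (V : lmodType F) N (e : 'I_N -> V) :
  (forall c : 'I_N -> F, \sum_i c i *: e i = 0 -> forall i, c i = 0) ->
  forall i j c, e i = c *: e j -> i = j.
Proof.
move=> e_free i j c e_ij.
have delta m : \sum_l (l == m)%:R *: e l = e m.
  rewrite (bigD1 m) //= eqxx scale1r big1 ?addr0 // => l /negPf->.
  exact: scale0r.
have /e_free/(_ i) : \sum_l ((l == i)%:R - c * (l == j)%:R) *: e l = 0.
  under eq_bigr do rewrite scalerBl -scalerA.
  by rewrite sumrB -scaler_sumr !delta e_ij subrr.
rewrite eqxx; case: eqP => // _.
by rewrite mulr0 subr0 => /eqP; rewrite oner_eq0.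
Qed.

Lemma subalg_closed_preimage (k : fieldType) (A C D : comAlgType k)
    (f : {lrmorphism A -> C}) (h : {lrmorphism D -> C}) :
  GRing.subalg_closed [in [set a | exists d, f a = h d]].
Proof.
split; first by rewrite inE; exists 1; rewrite !rmorph1.
  move=> c a1 a2; rewrite !inE => -[d1 e1] [d2 e2].
  by exists (c *: d1 + d2); rewrite !linearP /= e1 e2.
move=> a1 a2; rewrite !inE => -[d1 e1] [d2 e2].
by exists (d1 * d2); rewrite !rmorphM /= e1 e2.
Qed.

(** The partition of the lattice points into [I] and its complement that makes
    the degree 1 parts [v i] and [w i] of the monomials bases of the images of
    [A] and of [B], together with the face of the semigroup whose lattice points
    are those of [I].  A homomorphism into a domain cuts out a face, namely the
    monomials that it does not kill; the face wanted here is an intersection of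
    such faces.  The projection onto [A] removes the monomials lying in [B].  If
    a monomial [j] outside [I] has both parts nonzero, it is removed by the
    homomorphism that multiplies the image of [A] by [w j] and the image of [B]
    by [- v j]: this sends the monomial [i] to [v i * w j - w i * v j], which
    vanishes only for [i = j]. *)
Lemma splitting_face (R : realType) (n : nat) (k : fieldType)
    (P : set 'rV[R]_n) (A B : comAlgType k)
    (gA : nat -> set A) (gB : nat -> set B)
    (f : {lrmorphism A -> polytope_algebra k P})
    (g : {lrmorphism B -> polytope_algebra k P})
    (N : nat) (x : 'I_N -> 'rV[int]_n)
    (e := fun i => mono k (pt P (x i))) :
  normal_polytope k P ->
  graded_splitting (polytope_grading k P) gA gB f g ->
  injective x -> (forall y, lattice_points P y <-> exists i, y = x i) ->
  exists (a : 'I_N -> A)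
      (T : {lrmorphism polytope_algebra k P -> polytope_algebra k P})
      (I : {set 'I_N}) (C : 'M[k]_N) (face : semigroup P -> Prop),
    [/\ forall i, gA 1%N (a i),
        forall y, gA 1%N y -> T (f y) = f y,
        forall i, T (e i) = f (a i),
        forall j, f (a j) = \sum_(l in I) C j l *: f (a l) &
        forall j, e j - f (a j) =
          \sum_(l | l \notin I) C j l *: (e l - f (a l))] /\
    [/\ face (sg_zero P),
        forall s t, face (sg_add s t) <-> face s /\ face t &
        forall i, face (pt P (x i)) <-> i \in I].
Proof.
move=> normP split x_inj xP; have dom := normal_polytope_mulf_eq0 normP.
have e_gr i : polytope_grading k P 1 (e i).
  apply: polytope_grading_mono; apply: last_coord_pt.
  exact: (enum_lattice_point xP).
have [a aP] := choice (fun i => splitting_degree1 split (e_gr i)).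
have [b bP] := choice aP.
pose v i := f (a i); pose w i := g (b i).
have a_gr i : gA 1%N (a i) by case: (bP i).
have b_gr i : gB 1%N (b i) by case: (bP i).
have e_vw i : e i = v i + w i by case: (bP i).
have v_gr i : polytope_grading k P 1 (v i).
  exact: (splitting_gradedl split (a_gr i)).
have [p pE] := choice (fun i => degree1_span xP (v_gr i)).
(* The weights 1 and 0 project onto the image of [A]. *)
have [T [Tf Tg]] := splitting_hom split 1 0.
have Tv i : T (v i) = v i by rewrite /v (Tf _ (a_gr i)) mul1r.
have Tw i : T (w i) = 0 by rewrite /w (Tg _ (b_gr i)) mul0r.
have Te i : T (e i) = v i.
  by rewrite e_vw rmorphD /= Tv Tw addr0.
have v_p i : v i = \sum_j (\matrix_(i, j) p i j) i j *: e j.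
  by rewrite pE; apply: eq_bigr => j _; rewrite mxE.
have [I [C [vI wI vC wC]]] :=
  split_basis (degree1_free x_inj xP) e_vw v_p Tv Tw.
have [U UP] := choice (fun yz : polytope_algebra k P * polytope_algebra k P =>
  splitting_hom split yz.1 yz.2).
pose cross j := U (w j, - v j).
have crossE i j : cross j (e i) = v i * w j - w i * v j.
  have [Uf Ug] := UP (w j, - v j).
  rewrite e_vw rmorphD /= /v /w (Uf _ (a_gr i)) (Ug _ (b_gr i)) /=.
  by rewrite mulNr mulrC [g _ * _]mulrC.
pose face t := T (mono k t) != 0 /\
  forall j, j \notin I -> v j != 0 -> cross j (mono k t) != 0.
have nzM (h : {lrmorphism polytope_algebra k P -> polytope_algebra k P}) s t :
    h (mono k (sg_add s t)) != 0 <-> h (mono k s) != 0 /\ h (mono k t) != 0.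
  exact: rmorph_mono_neq0.
have face0 : face (sg_zero P).
  split=> [|j _ _]; rewrite mono0 rmorph1; exact: oner_neq0.
have faceD s t : face (sg_add s t) <-> face s /\ face t.
  split=> [[/nzM[Ts Tt] cst]|[[Ts cs] [Tt ct]]].
    split; split; [exact: Ts | | exact: Tt |] => j jI vj.
      by have /nzM[cs _] := cst j jI vj; exact: cs.
    by have /nzM[_ ct] := cst j jI vj; exact: ct.
  split; first by apply/nzM; split; [exact: Ts | exact: Tt].
  by move=> j jI vj; apply/nzM; split; [exact: cs | exact: ct].
have face_pt i : face (pt P (x i)) <-> i \in I.
  split=> [[Ti ci]|iI].
    apply/negPn/negP => iI; rewrite Te in Ti.
    have := ci i iI Ti; rewrite crossE.
    by rewrite [w i * v i]mulrC subrr eqxx.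
  split=> [|j jI vj]; first by rewrite Te; apply: vI.
  apply/negP => /eqP; rewrite crossE => /eqP; rewrite subr_eq0 => /eqP.
  rewrite [w i * v j]mulrC => vw.
  have [c [vc wc]] := splitting_proportional split vw vj (wI j jI).
  have e_ij : e i = c *: e j by rewrite !e_vw scalerDr -vc -wc.
  have ij := free_proportional (degree1_free x_inj xP) e_ij.
  by rewrite ij (negPf jI) in iI.
exists a, T, I, C, face; split; split; first exact: a_gr.
- by move=> y gy; rewrite (Tf _ gy) mul1r.
- exact: Te.
- exact: vC.
- have wE j : e j - f (a j) = w j by rewrite e_vw addrC addKr.
  move=> j; apply: etrans (wE j) (etrans (wC j) _).
  by apply: eq_bigr => l _; rewrite -wE.
- exact: face0.
- exact: faceD.
- exact: face_pt.
Qed.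

(** The isomorphism [F] from [A] to the algebra of the face polytope [Q] is the
    restriction to [A] of the retraction [ret].  In the opposite direction the
    projection [T] onto [A] maps the algebra of [Q] onto [A], because the
    [f (a l)] with [l] in [I] span the image of [A] in degree 1.  Both maps are
    surjective, so their composite [E] is a surjective graded endomorphism of the
    algebra of [Q], hence injective, and therefore [F] is injective. *)
Lemma splitting_polytopal (R : realType) (n : nat) (k : fieldType)
    (P : set 'rV[R]_n) (A B : comAlgType k)
    (gA : nat -> set A) (gB : nat -> set B)
    (f : {lrmorphism A -> polytope_algebra k P})
    (g : {lrmorphism B -> polytope_algebra k P}) :
  lattice_polytope P -> normal_polytope k P -> standard_graded gA ->
  graded_splitting (polytope_grading k P) gA gB f g -> polytopal R gA.
Proof.
move=> polyP normP stdA split.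
have [N [x [x_inj xP]]] := lattice_points_finite polyP.
pose e i := mono k (pt P (x i)).
have [a [T [I [C [face [[a_gr Tf Te fC eC] [face0 faceD face_pt]]]]]]] :=
  splitting_face normP split x_inj xP.
pose Q := @face_polytope R n N x I.
have QP := face_lattice_pointsP polyP xP face0 faceD face_pt.
have polyQ : lattice_polytope Q by exact: face_polytope_lattice.
have [inc incE] := face_inclusion k polyP xP face0 faceD face_pt.
have [ret [retI retJ ret_gr]] := face_retraction k xP face0 faceD face_pt.
(* A preimage of [f (a j)] in the algebra of [Q]. *)
pose r j := \sum_(l in I) C j l *: mono k (pt Q (x l)).
have rE j : T (inc (r j)) = f (a j).
  rewrite /r linear_sum /= linear_sum /= fC; apply: eq_bigr => l lI.
  by rewrite !linearZ /= (incE _ lI) Te.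
pose E : {lrmorphism polytope_algebra k Q -> polytope_algebra k Q} :=
  ret \o (T \o inc).
pose F : {lrmorphism A -> polytope_algebra k Q} := ret \o f.
have Er j : E (r j) = F (a j) by rewrite /= rE.
(* Modulo the monomials outside [I] the elements [e l - f (a l)] with [l] outside
   [I] become [- f (a l)], so that every monomial of [Q] comes from [A]. *)
have XQ i : i \in I -> mono k (pt Q (x i)) =
    F (a i - \sum_(l | l \notin I) C i l *: a l).
  move=> iI; rewrite -(retI i iI) -[mono k _]/(e i).
  have -> : ret (e i) = ret (f (a i)) + ret (e i - f (a i)).
    by rewrite -rmorphD addrC subrK.
  have -> : F (a i - \sum_(l | l \notin I) C i l *: a l) =
            F (a i) - \sum_(l | l \notin I) C i l *: F (a l).
    have <- : F (\sum_(l | l \notin I) C i l *: a l) =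
              \sum_(l | l \notin I) C i l *: F (a l).
      by rewrite linear_sum; apply: eq_bigr => l _; rewrite linearZ.
    exact: rmorphB.
  congr (_ + _).
  rewrite eC linear_sum -sumrN.
  apply: eq_bigr => l lI; rewrite linearZ /= -scalerN; congr (_ *: _).
  have -> : ret (e l - f (a l)) = ret (e l) - ret (f (a l)) by exact: rmorphB.
  by rewrite (retJ l lI) sub0r.
have F_surj u : exists a', u = F a'.
  suff : u \in [set u | exists a', idfun u = F a'] by rewrite inE.
  apply: subalg_closed_full; first exact: subalg_closed_preimage.
  by move=> y /QP[i iI ->]; rewrite inE; eexists; apply: XQ.
have E_surj t : exists u, E u = mono k t.
  suff : mono k t \in [set u | exists u', idfun u = E u'].
    by rewrite inE => -[u uE]; exists u.
  apply: subalg_closed_full; first exact: subalg_closed_preimage.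
  move=> y /QP[i iI ->]; rewrite inE.
  exists (r i - \sum_(l | l \notin I) C i l *: r l).
  have ES : E (\sum_(l | l \notin I) C i l *: r l) =
            F (\sum_(l | l \notin I) C i l *: a l).
    rewrite !linear_sum; apply: eq_bigr => l _.
    by rewrite !linearZ; congr (_ *: _); exact: Er.
  rewrite /= (XQ i iI) !rmorphB.
  by congr (_ - _); [exact: esym (Er i) | exact: esym ES].
have E_gr (t : semigroup Q) h : last_coord t = h%:Z ->
    polytope_grading k Q h (E (mono k t)).
  elim/semigroup_ind: t h => [|s t IHs IHt|y Qy] h.
  - by move=> h0; rewrite mono0 rmorph1 -mono0; apply: polytope_grading_mono.
  - have [i si] := last_coord_nat s; have [j tj] := last_coord_nat t.
    rewrite last_coordD si tj -PoszD => -[<-]; rewrite monoD rmorphM.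
    by apply: polytope_grading_mul; [apply: IHs | apply: IHt].
  rewrite last_coord_pt // => -[<-]; have /QP[i iI ->] := Qy.
  by rewrite /= (incE _ iI) Te; apply/ret_gr/(splitting_gradedl split).
have E_inj := graded_surj_inj polyQ E_gr E_surj.
have f_im a' : exists u, f a' = (T \o inc) u.
  suff : a' \in [set a' | exists u, f a' = (T \o inc) u] by rewrite inE.
  have : subalg_generated (gA 1%N) a' by rewrite (standard_degree1 stdA).
  apply; first exact: subalg_closed_preimage.
  move=> y gy; rewrite inE.
  have [c cE] := degree1_span xP (splitting_gradedl split gy).
  exists (\sum_i c i *: r i).
  rewrite -(Tf _ gy) [in LHS]cE !linear_sum /=; apply: eq_bigr => i _.
  by rewrite !linearZ /= rE Te.
have F_inj a' : F a' = 0 -> a' = 0.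
  have [u uE] := f_im a'; rewrite /= uE => /E_inj u0.
  by apply: (splitting_injl split); rewrite uE u0 !rmorph0.
have F_gr h a' : gA h a' -> polytope_grading k Q h (F a').
  by move=> ga; apply: ret_gr; apply: (splitting_gradedl split).
exists n, Q; split; first exact: polyQ.
exists F; split.
  have [F' F'E] := choice F_surj.
  exists F' => [a'|u]; last exact: esym (F'E u).
  apply/eqP; rewrite -subr_eq0; apply/eqP/F_inj.
  have -> : F (F' (F a') - a') = F (F' (F a')) - F a' by exact: rmorphB.
  by rewrite -F'E; exact: subrr.
move=> h a'; split; first exact: F_gr.
exact: (graded_inj_reflects stdA F_gr F_inj).
Qed.

Theorem theorem3p1 (R : realType) (k : closedFieldType)
    (A B : comAlgType k) (gA : nat -> set A) (gB : nat -> set B)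
    (stdA : standard_graded gA) (stdB : standard_graded gB)
    (AB : comAlgType k) (tens : {bilinear A -> B -> AB})
    (tensAB : is_tensor_product tens)
    (n : nat) (P : set 'rV[R]_n)
    (polyP : lattice_polytope P) (normP : normal_polytope k P)
    (isoP : graded_iso (tensor_grading tens gA gB) (polytope_grading k P)) :
  polytopal R gA /\ polytopal R gB.
Proof.
have [f [g split]] := tensor_splitting stdA stdB tensAB normP isoP.
split; first exact: splitting_polytopal polyP normP stdA split.
exact: splitting_polytopal polyP normP stdB (splitting_sym split).
Qed.
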